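(* Let $k\ge 2$ be an integer and $c_k := 4\cos^2\frac{\pi}{k+1}$. For every real $c\ge c_k$ and every matrix $M$: (i) if $M\in TP_2(c)$, then $M\in TP_k$; (ii) if $M\in STP_2(c)$, then $M\in STP_k$.
   Context: For $c\ge 1$, $TP_2(c)$ denotes the class of all real matrices $M=(a_{i,j})$ with positive entries such that $a_{i,j}a_{i+1,j+1}\ge c\, a_{i,j+1}a_{i+1,j}$ for all $i,j$ (for which these entries exist). $STP_2(c)$ denotes the class of all real matrices $M=(a_{i,j})$ with positive entries such that $a_{i,j}a_{i+1,j+1}> c\, a_{i,j+1}a_{i+1,j}$ for all $i,j$ (for which these entries exist). $TP_k$ is the class of matrices all of whose minors of order not greater than $k$ are non-negative; $STP_k$ is the class of matrices all of whose minors of order not greater than $k$ are strictly positive. (Minors are determinants of square submatrices formed by arbitrary, not necessarily consecutive, rows and columns taken in increasing order.) *)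

(* Defs.v *)
From HB Require Import structures.
From mathcomp Require Import all_boot all_order all_algebra.
From mathcomp Require Import reals trigo.

Set Implicit Arguments.
Unset Strict Implicit.
Unset Printing Implicit Defensive.

Import Order.TTheory GRing.Theory Num.Theory.
Local Open Scope ring_scope.

(* The primed indices are the successors: quantifying over i' with i' = i + 1
   restricts the condition to those i, j for which all four entries exist. *)
Definition TP2 (R : realType) (c : R) (m n : nat) (M : 'M[R]_(m, n)) : Prop :=
  (forall i j, 0 < M i j) /\
  (forall (i i' : 'I_m) (j j' : 'I_n), i' = i.+1 :> nat -> j' = j.+1 :> nat ->
     M i j * M i' j' >= c * M i j' * M i' j).

Definition STP2 (R : realType) (c : R) (m n : nat) (M : 'M[R]_(m, n)) : Prop :=
  (forall i j, 0 < M i j) /\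
  (forall (i i' : 'I_m) (j j' : 'I_n), i' = i.+1 :> nat -> j' = j.+1 :> nat ->
     M i j * M i' j' > c * M i j' * M i' j).

Definition ord_increasing (p m : nat) (f : 'I_p -> 'I_m) : Prop :=
  forall a b : 'I_p, (a < b)%N -> (f a < f b)%N.

(* The rows and columns of a minor need not be consecutive.  The order p = 0 is
   harmless: the empty determinant is 1. *)
Definition TP (R : realType) (k m n : nat) (M : 'M[R]_(m, n)) : Prop :=
  forall (p : nat) (f : 'I_p -> 'I_m) (g : 'I_p -> 'I_n),
    (p <= k)%N -> ord_increasing f -> ord_increasing g ->
    0 <= \det (mxsub f g M).

Definition STP (R : realType) (k m n : nat) (M : 'M[R]_(m, n)) : Prop :=
  forall (p : nat) (f : 'I_p -> 'I_m) (g : 'I_p -> 'I_n),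
    (p <= k)%N -> ord_increasing f -> ord_increasing g ->
    0 < \det (mxsub f g M).

Definition ck (R : realType) (k : nat) : R := 4 * cos (pi / k.+1%:R) ^+ 2.

(* Main.v *)
Require Import Defs.
From HB Require Import structures.
From mathcomp Require Import all_boot all_order all_algebra.
From mathcomp Require Import reals trigo.
From mathcomp Require Import zify ring.

Set Implicit Arguments.
Unset Strict Implicit.
Unset Printing Implicit Defensive.

Import Order.TTheory GRing.Theory Num.Theory.
Local Open Scope ring_scope.

(** Let [t = pi / (k + 1)], so that the threshold is [c = 4 cos^2 t >= 1].
    Multiplying adjacent inequalities spreads the gap [c] from consecutive to
    arbitrary pairs of rows and columns ([gap_spread]), so every square submatrix
    again satisfies the hypothesis, and only the determinant of a matrix [A] of
    order [p <= k] has to be studied.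

    For tridiagonal matrices the threshold is explained by the continuant
    recurrence: writing [D] for the determinant and [D'], [D''] for what remains
    after deleting the first one, resp. two, rows and columns, one has
    [D = a_00 D' - a_01 a_10 D'']; hence the normalised ratio [D / (a_00 D')] is
    bounded below by the sequence [r_0 = 1], [r_(n+1) = 1 - 1 / (c r_n)].  Its
    closed form is [r_n = sin ((n+2) t) / (2 cos t sin ((n+1) t))], which stays
    positive up to [n = k - 2] and vanishes at [n = k - 1].

    The point is that the tridiagonal case is extremal: for every [A] with gap [c]
    and order at most [k],
    [a_00 D' - a_01 a_10 D'' <= D <= a_00 D']  ([leading_minor_three_term]).
    Expand [D] along its first row.  The terms alternate in sign, and their absolute
    values [a_0j P_j] decrease with [j] ([first_row_terms_decrease]); so [D] lies
    between [a_00 D' - a_01 P_1] and [a_00 D'], and [P_1 <= a_10 D''] by induction.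
    The decrease is itself inductive.  The minors [P_j] and [P_(j+1)] have the same
    lower right block once [j + 1] diagonal entries are peeled off
    ([peel_diagonal]).  Each peeling loses at most a factor [1 / c], because
    [r_(n+1) >= 0] forces [r_n >= 1 / c] ([cos_ratio_geVck]); in all at most
    [c^-(j+1)].  The diagonals differ in one entry, and comparing
    [a_0(j+1) a_(j+1)j] with [a_0j a_(j+1)(j+1)] gains [c^(j+1)], one factor for
    each row step ([gap_kernel_pow]).  Gain and loss cancel exactly.

    Finally [D' >= r_(p-2) a_11 D'' >= a_11 D'' / c] turns the lower bound into
    [D >= (a_00 a_11 / c - a_01 a_10) D''] with [D'' > 0], which is nonnegative or
    positive according to the hypothesis on the first 2 x 2 block.  Both versions
    are treated together by an inequality [x < y ?<= if C]. *)

(** * The continuant ratios at the critical constant *)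

(** The closed form of [r_0 = 1], [r_(n+1) = 1 - 1 / (ck R k * r_n)]: the pivots of
    the tridiagonal Toeplitz matrix for which every 2 x 2 gap is exactly
    [ck R k], normalised by their diagonal entries. *)
Definition cos_ratio (R : realType) (k n : nat) : R :=
  let t := pi / k.+1%:R in
  sin (n.+2%:R * t) / (2 * cos t * sin (n.+1%:R * t)).

Lemma pi_fraction_bounds (R : realType) (k n : nat) :
  (0 < n <= k)%N -> 0 < (n%:R * (pi / k.+1%:R) : R) < pi.
Proof.
move=> /andP[n0 nk]; have p0 := pi_gt0 R.
have k0 : 0 < (k.+1%:R : R) by rewrite ltr0n.
rewrite mulr_gt0 ?ltr0n ?divr_gt0 //= mulrCA gtr_pMr //.
by rewrite ltr_pdivrMr // mul1r ltr_nat.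
Qed.

Lemma cos_pi_fraction_gt0 (R : realType) (k : nat) :
  (1 < k)%N -> 0 < cos (pi / k.+1%:R : R).
Proof.
move=> k1; have p0 := pi_gt0 R; apply: cos_gt0_pihalf.
have t0 : 0 < pi / k.+1%:R :> R by rewrite divr_gt0 ?ltr0n.
rewrite (lt_trans _ t0) ?oppr_lt0 ?divr_gt0 //=.
by rewrite ltr_pM2l // ltf_pV2 ?posrE ?ltr0n ?ltr_nat // ltnS.
Qed.

Lemma ck_gt0 (R : realType) (k : nat) : (1 < k)%N -> 0 < ck R k.
Proof. by move=> k1; rewrite mulr_gt0 ?exprn_gt0 ?cos_pi_fraction_gt0. Qed.

Lemma cos_ratio0 (R : realType) (k : nat) : (1 < k)%N -> cos_ratio R k 0 = 1.
Proof.
move=> k1; have c0 := cos_pi_fraction_gt0 R k1.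
have s0 : 0 < sin (pi / k.+1%:R : R).
  have := @pi_fraction_bounds R k 1 (ltnW k1).
  by rewrite mul1r => /sin_gt0_pi.
rewrite /cos_ratio mul1r mulr_natl sin_mulr2n -mulrA mulr_natl divff //.
by rewrite gt_eqF // pmulrn_lgt0 // mulr_gt0.
Qed.

(** With [t = pi / (k + 1)] this is the addition formula
    [sin ((n+3) t) + sin ((n+1) t) = 2 cos t * sin ((n+2) t)]. *)
Lemma cos_ratioS (R : realType) (k n : nat) : (n.+2 <= k)%N ->
  cos_ratio R k n.+1 = 1 - (ck R k * cos_ratio R k n)^-1.
Proof.
move=> nk; have k1 : (1 < k)%N by apply: leq_trans nk.
have := cos_pi_fraction_gt0 R k1.
have b n' : (0 < n' <= k)%N -> 0 < sin (n'%:R * (pi / k.+1%:R) : R).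
  by move=> h; rewrite sin_gt0_pi // pi_fraction_bounds.
have := b n.+1 (ltnW nk); have := b n.+2 nk; rewrite /cos_ratio /ck.
have -> : sin (n.+3%:R * (pi / k.+1%:R)) =
   2 * cos (pi / k.+1%:R) * sin (n.+2%:R * (pi / k.+1%:R))
   - sin (n.+1%:R * (pi / k.+1%:R)) :> R.
  set t := pi / _.
  have -> : n.+3%:R * t = n.+2%:R * t + t by rewrite -[n.+3]addn1 natrD; ring.
  have -> : n.+1%:R * t = n.+2%:R * t - t by rewrite -[n.+2]addn1 natrD; ring.
  by rewrite sinD sinB; ring.
set x := cos _; set y := sin _; set z := sin _ => y0 z0 x0.
field.
by rewrite !gt_eqF.
Qed.

Lemma cos_ratio_gt0 (R : realType) (k n : nat) : (n.+1 < k)%N ->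
  0 < cos_ratio R k n.
Proof.
move=> nk; have k1 : (1 < k)%N by apply: leq_trans nk.
rewrite divr_gt0 ?mulr_gt0 ?cos_pi_fraction_gt0 //.
  by rewrite sin_gt0_pi ?pi_fraction_bounds.
by rewrite sin_gt0_pi ?pi_fraction_bounds // (ltnW nk).
Qed.

(** The numerator is [sin pi]: the order [k] is where the critical tridiagonal
    matrix becomes singular. *)
Lemma cos_ratio_last (R : realType) (k : nat) : cos_ratio R k.+1 k = 0.
Proof. by rewrite /cos_ratio [_ * (pi / _)]mulrC divfK ?pnatr_eq0 // sinpi mul0r. Qed.

(** The next ratio, [1 - 1 / (ck R k * cos_ratio R k n)], is still
    nonnegative. *)
Lemma cos_ratio_geVck (R : realType) (k n : nat) : (n.+1 < k)%N ->
  (ck R k)^-1 <= cos_ratio R k n.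
Proof.
move=> nk; have k1 : (1 < k)%N by apply: leq_trans nk.
have : 0 <= cos_ratio R k n.+1.
  move: nk; rewrite leq_eqVlt => /orP[/eqP <-|nk]; first by rewrite cos_ratio_last.
  by rewrite ltW ?cos_ratio_gt0.
rewrite cos_ratioS // subr_ge0 invfM => h.
by rewrite -ler_pdivlMr ?invr_gt0 ?cos_ratio_gt0 // invrK mul1r in h.
Qed.

(** The bound of [cos_ratio_geVck] at the initial ratio, which is 1. *)
Lemma ck_ge1 (R : realType) (k : nat) : (1 < k)%N -> 1 <= ck R k.
Proof.
move=> k1; have := cos_ratio_geVck R k1; rewrite cos_ratio0 //.
by rewrite invf_le1 ?ck_gt0.
Qed.

(** * Gaps between arbitrary rows and columns *)

(** In terms of the ratios [x' / x], [y' / y], [z' / z] of two columns in three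
    rows: a growth by a factor [c >= 1] at both steps is a growth by at least [c]
    overall.  Strictness of the first step suffices. *)
Lemma row_gap_trans (R : realFieldType) (C : bool) (c x x' y y' z z' : R) :
  1 <= c -> 0 < x -> 0 < y -> 0 < z -> 0 < y' ->
  c * x' * y < x * y' ?<= if C -> c * y' * z <= y * z' ->
  c * x' * z < x * z' ?<= if C.
Proof.
move=> c1 x0 y0 z0 y'0 h1 h2.
have h3 : x * y' * z <= x * z' * y.
  have -> : x * z' * y = x * (y * z') by ring.
  rewrite -mulrA ler_pM2l // (le_trans _ h2) // -mulrA.
  by rewrite ler_peMl // mulr_ge0 // ltW.
have e : c * x' * z * y = c * x' * y * z by ring.
case: C h1 => /= h1.
  by rewrite -(ler_pM2r y0) e (le_trans _ h3) // ler_pM2r.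
by rewrite -(ltr_pM2r y0) e (lt_le_trans _ h3) // ltr_pM2r.
Qed.

Lemma row_gap_spread (R : realFieldType) (C : bool) (c : R) (m n : nat)
    (M : 'M[R]_(m, n)) (j j' : 'I_n) :
  1 <= c -> (forall i l, 0 < M i l) ->
  (forall i i' : 'I_m, i' = i.+1 :> nat ->
     c * M i j' * M i' j < M i j * M i' j' ?<= if C) ->
  forall i i' : 'I_m, (i < i')%N ->
     c * M i j' * M i' j < M i j * M i' j' ?<= if C.
Proof.
move=> c1 M0 adj i i'; move: {2}(i' : nat) (erefl (i' : nat)) => s.
elim: s i' => [|s IH] i' ei'; first by rewrite ei'.
rewrite ei' ltnS leq_eqVlt => /orP[/eqP ei|lt_is].
  by apply: adj; rewrite ei' ei.
have ltsm : (s < m)%N by rewrite ltnW // -ei'.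
(* The intermediate row is the predecessor [s] of [i']. *)
apply: (row_gap_trans (y := M (Ordinal ltsm) j) (y' := M (Ordinal ltsm) j')) => //.
  exact: IH.
by apply: (lteifW (C := C)); apply: adj; rewrite ei'.
Qed.

(** The condition is symmetric under transposition, so spreading along rows and then
    along columns reduces to [row_gap_spread] for [M] and for its transpose. *)
Lemma gap_spread (R : realFieldType) (C : bool) (c : R) (m n : nat)
    (M : 'M[R]_(m, n)) :
  1 <= c -> (forall i l, 0 < M i l) ->
  (forall (i i' : 'I_m) (j j' : 'I_n), i' = i.+1 :> nat -> j' = j.+1 :> nat ->
     c * M i j' * M i' j < M i j * M i' j' ?<= if C) ->
  forall (i i' : 'I_m) (j j' : 'I_n), (i < i')%N -> (j < j')%N ->
     c * M i j' * M i' j < M i j * M i' j' ?<= if C.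
Proof.
move=> c1 M0 adj i i' j j' lti ltj.
have H : c * M^T j i' * M^T j' i < M^T j i * M^T j' i' ?<= if C.
  apply: row_gap_spread => // [a b|a b eb]; first by rewrite mxE.
  rewrite !mxE mulrAC; apply: row_gap_spread => // s s' es.
  exact: adj.
by move: H; rewrite !mxE mulrAC.
Qed.

(** * Determinants of kernels *)

(** Matrices are handled as functions on [nat * nat], of which only the corner of the
    relevant order matters: deleting rows and columns then changes neither the type
    nor the order of the ambient object. *)
Definition leading_minor (R : realType) (n : nat) (A : nat -> nat -> R) : R :=
  \det (\matrix_(i < n, j < n) A i j).

Definition kernel_shift (R : realType) (s : nat) (A : nat -> nat -> R) :=
  fun i j : nat => A (s + i)%N (s + j)%N.

(** Row 0 and column [j] are deleted; [bump j] skips the value [j]. *)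
Definition kernel_minor (R : realType) (j : nat) (A : nat -> nat -> R) :=
  fun i l : nat => A i.+1 (bump j l).

Definition gap_kernel (R : realType) (c : R) (n : nat) (A : nat -> nat -> R) :=
  (forall i j, (i < n)%N -> (j < n)%N -> 0 < A i j) /\
  (forall i i' j j', (i < i' < n)%N -> (j < j' < n)%N ->
     c * A i j' * A i' j <= A i j * A i' j').

Lemma leading_minor0 (R : realType) (A : nat -> nat -> R) :
  leading_minor 0 A = 1.
Proof. exact: det_mx00. Qed.

Lemma eq_leading_minor (R : realType) (n : nat) (A B : nat -> nat -> R) :
  (forall i j, A i j = B i j) -> leading_minor n A = leading_minor n B.
Proof. by move=> AB; congr (\det _); apply/matrixP => i j; rewrite !mxE. Qed.

Lemma leading_minor_expand (R : realType) (n : nat) (A : nat -> nat -> R) :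
  leading_minor n.+1 A =
  \sum_(j < n.+1) (-1) ^+ j * (A 0%N j * leading_minor n (kernel_minor j A)).
Proof.
rewrite /leading_minor (expand_det_row _ ord0); apply: eq_bigr => j _.
rewrite mxE mulrCA /cofactor add0n; congr (_ * (_ * \det _)).
by apply/matrixP => i l; rewrite !mxE lift0.
Qed.

Lemma gap_kernel_sub (R : realType) (c : R) (m n : nat) (f g : nat -> nat)
    (A : nat -> nat -> R) :
  {homo f : i j / (i < j)%N} -> {homo g : i j / (i < j)%N} ->
  (forall i, (i < m)%N -> (f i < n)%N) -> (forall i, (i < m)%N -> (g i < n)%N) ->
  gap_kernel c n A -> gap_kernel c m (fun i j => A (f i) (g j)).
Proof.
move=> fh gh fm gm [A0 Ag]; split=> [i j im jm|i i' j j'].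
  by apply: A0; [apply: fm|apply: gm].
by move=> /andP[ii im] /andP[jj jm]; apply: Ag; rewrite ?fh ?gh ?fm ?gm.
Qed.

Lemma gap_kernel_shift (R : realType) (c : R) (s m : nat) (A : nat -> nat -> R) :
  gap_kernel c (s + m) A -> gap_kernel c m (kernel_shift s A).
Proof. by apply: gap_kernel_sub => i *; rewrite ltn_add2l. Qed.

Lemma gap_kernel_minor (R : realType) (c : R) (j n : nat) (A : nat -> nat -> R) :
  gap_kernel c n.+1 A -> gap_kernel c n (kernel_minor j A).
Proof.
apply: (gap_kernel_sub (f := succn) (g := bump j)) => // [i l il|i im].
  by rewrite /bump; lia.
by rewrite /bump; lia.
Qed.

(** The ratio of column [j.+1] to column [j] grows by a factor [c] at each of the [i]
    row steps.  The full power is what pays for the losses in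
    [first_row_terms_decrease]. *)
Lemma gap_kernel_pow (R : realType) (c : R) (n i j : nat) (A : nat -> nat -> R) :
  0 <= c -> gap_kernel c n A -> (i < n)%N -> (j.+1 < n)%N ->
  c ^+ i * A 0%N j.+1 * A i j <= A 0%N j * A i j.+1.
Proof.
move=> c0 [A0 Ag] im jn; elim: i im => [|i IH] im.
  by rewrite expr0 mul1r mulrC.
have {}IH := IH (ltnW im).
have gap := Ag i i.+1 j j.+1.
rewrite !ltnSn im jn /= in gap; have {}gap := gap isT isT.
have w := A0 i j (ltnW im) (ltnW jn).
have x := A0 i j.+1 (ltnW im) jn.
have y := A0 i.+1 j im (ltnW jn).
have z := A0 0%N j.+1 (leq_ltn_trans (leq0n _) im) jn.
rewrite -(ler_pM2r (mulr_gt0 w x)).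
have -> : c ^+ i.+1 * A 0%N j.+1 * A i.+1 j * (A i j * A i j.+1) =
   (c ^+ i * A 0%N j.+1 * A i j) * (c * A i j.+1 * A i.+1 j).
  by rewrite exprS; ring.
have -> : A 0%N j * A i.+1 j.+1 * (A i j * A i j.+1) =
   (A 0%N j * A i j.+1) * (A i j * A i.+1 j.+1) by ring.
by apply: ler_pM => //; rewrite !mulr_ge0 ?exprn_ge0 // ltW.
Qed.

(** Leibniz's estimate: removing the first term leaves an alternating sum of the same
    kind. *)
Lemma alternating_sum_bounds (R : realDomainType) (n : nat) (T : nat -> R) :
  (forall j, (j <= n)%N -> 0 <= T j) ->
  (forall j, (j < n)%N -> T j.+1 <= T j) ->
  0 <= \sum_(j < n.+1) (-1) ^+ j * T j <= T 0%N.
Proof.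
elim: n T => [|n IH] T T0 Td.
  by rewrite big_ord1 expr0 mul1r T0 /=.
have /andP[s0 s1] := IH (fun j => T j.+1) (fun j => T0 j.+1) (fun j => Td j.+1).
rewrite big_ord_recl expr0 mul1r.
under eq_bigr => j _ do rewrite lift0 exprS mulN1r mulNr.
rewrite sumrN gerBl s0 andbT subr_ge0 (le_trans s1) //.
exact: Td.
Qed.

(** * Comparison with the tridiagonal case *)

(** The induction hypothesis on the order [n.+1], for all kernels at once: the minors
    met in the induction are not corners of the original kernel. *)
Definition corner_bounds (R : realType) (k n : nat) :=
  forall A : nat -> nat -> R, gap_kernel (ck R k) n.+1 A ->
  cos_ratio R k n * A 0%N 0%N * leading_minor n (kernel_shift 1 A)
    <= leading_minor n.+1 A
    <= A 0%N 0%N * leading_minor n (kernel_shift 1 A).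

Lemma leading_minor_gt0 (R : realType) (k n : nat) (A : nat -> nat -> R) :
  (forall m, (m < n)%N -> corner_bounds R k m) -> (n < k)%N ->
  gap_kernel (ck R k) n A -> 0 < leading_minor n A.
Proof.
elim: n A => [|n IH] A H nk GA; first by rewrite leading_minor0.
have /andP[lo _] := H n (ltnSn n) A GA; apply: lt_le_trans lo.
have A0 : 0 < A 0%N 0%N by case: GA => + _; apply.
apply: mulr_gt0; first by apply: mulr_gt0 A0; apply: cos_ratio_gt0.
apply: IH => [m mn||]; [exact/H/ltnW|exact: ltnW|exact: gap_kernel_shift].
Qed.

(** Iterating the corner bounds: every ratio that occurs is at least
    [(ck R k)^-1], since the orders involved are smaller than [k]. *)
Lemma peel_diagonal (R : realType) (k s t : nat) (A : nat -> nat -> R) :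
  (forall m, (m < s + t)%N -> corner_bounds R k m) -> (s + t < k)%N ->
  gap_kernel (ck R k) (s + t) A ->
  (ck R k)^-1 ^+ s * (\prod_(i < s) A i i) * leading_minor t (kernel_shift s A)
    <= leading_minor (s + t) A
    <= (\prod_(i < s) A i i) * leading_minor t (kernel_shift s A).
Proof.
elim: s A => [|s IH] A H stk GA.
  rewrite expr0 big_ord0 !mul1r add0n.
  by rewrite (@eq_leading_minor _ t (kernel_shift 0 A) A) ?lexx.
have GB : gap_kernel (ck R k) (s + t) (kernel_shift 1 A).
  exact: gap_kernel_shift.
have k1 : (1 < k)%N by lia.
have c0 := ck_gt0 R k1.
have A0 : 0 < A 0%N 0%N by case: GA => + _; apply.
have /andP[lo hi] := H _ (ltnSn (s + t)) A GA.
have /andP[lo' hi'] :=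
  IH _ (fun m ms => H m (ltnW ms)) (ltnW stk) GB.
have B0 : 0 < leading_minor (s + t) (kernel_shift 1 A).
  by apply: leading_minor_gt0 GB => [m ms|]; [exact/H/ltnW|exact: ltnW].
rewrite big_ord_recl; apply/andP; split; last first.
  by apply: (le_trans hi); rewrite -[leRHS]mulrA ler_pM2l.
apply: le_trans lo.
have r : (ck R k)^-1 <= cos_ratio R k (s + t) by rewrite cos_ratio_geVck.
apply: (@le_trans _ _ ((ck R k)^-1 * A 0%N 0%N
                       * leading_minor (s + t) (kernel_shift 1 A))).
  rewrite exprS; set a := _ ^+ s in lo' *; set P := \prod_(i < s) _ in lo' *.
  set Z := leading_minor t _ in lo'.
  rewrite [leLHS](_ : _ = (ck R k)^-1 * A 0%N 0%N * (a * P * Z)).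
    by rewrite ler_pM2l ?mulr_gt0 ?invr_gt0.
  by rewrite /P /Z; ring.
have D0 := mulr_gt0 A0 B0.
move: r; set q := cos_ratio R k _ => r.
by rewrite -mulrA -[leRHS]mulrA ler_pM2r.
Qed.

(** Peel [j.+1] diagonal entries off both minors: the remaining blocks coincide, the
    diagonals agree except for the last peeled entry, and the loss
    [(ck R k)^-1 ^+ j.+1] is compensated by [gap_kernel_pow]. *)
Lemma first_row_terms_decrease (R : realType) (k n j : nat)
    (A : nat -> nat -> R) :
  (forall m, (m < n)%N -> corner_bounds R k m) -> (n < k)%N ->
  gap_kernel (ck R k) n.+1 A -> (j < n)%N ->
  A 0%N j.+1 * leading_minor n (kernel_minor j.+1 A)
    <= A 0%N j * leading_minor n (kernel_minor j A).
Proof.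
move=> H nk GA jn.
have k1 : (1 < k)%N by lia.
have c0 := ck_gt0 R k1.
have pow := @gap_kernel_pow R _ _ j.+1 j A (ltW c0) GA.
rewrite !ltnS jn in pow; have {}pow := pow isT isT.
have A0 i l : (i <= n)%N -> (l <= n)%N -> 0 < A i l by case: GA => + _; apply.
(* [t] is the order of the common trailing block. *)
have [t nt] : {t | n = (j.+1 + t)%N} by exists (n - j.+1)%N; rewrite subnKC.
have G1 := gap_kernel_minor j.+1 GA; have G0 := gap_kernel_minor j GA.
rewrite {1}nt in G1; rewrite {1}nt in G0.
have H' : forall m, (m < j.+1 + t)%N -> corner_bounds R k m.
  by move=> m; rewrite -nt; apply: H.
have nk' : (j.+1 + t < k)%N by rewrite -nt.
have /andP[_ hi] := peel_diagonal H' nk' G1.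
have /andP[lo _] := peel_diagonal H' nk' G0.
rewrite -nt in hi lo.
have Gs := gap_kernel_shift G0.
have Z0 : 0 < leading_minor t (kernel_shift j.+1 (kernel_minor j A)).
  by apply: leading_minor_gt0 Gs => [m ms|]; [apply: H'|]; lia.
rewrite (@eq_leading_minor _ _ (kernel_shift j.+1 (kernel_minor j.+1 A))
  (kernel_shift j.+1 (kernel_minor j A))) in hi; last first.
  by move=> i l; rewrite /kernel_shift /kernel_minor /bump; congr (A _ _); lia.
set Z := leading_minor t _ in hi lo Z0.
rewrite !big_ord_recr /= in hi lo.
have eP l : (j <= l)%N -> \prod_(i < j) kernel_minor l A i i = \prod_(i < j) A i.+1 i.
  move=> jl; apply: eq_bigr => i _; rewrite /kernel_minor /bump.
  by rewrite leqNgt (leq_trans (ltn_ord i) jl).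
rewrite !eP // in hi lo; set P := \prod_(i < j) _ in hi lo.
have P0 : 0 < P by apply: prodr_gt0 => i _; apply: A0; have := ltn_ord i; lia.
(* The last peeled entries: here the two diagonals part. *)
have e1 : kernel_minor j.+1 A j j = A j.+1 j by rewrite /kernel_minor /bump ltnn.
have e0 : kernel_minor j A j j = A j.+1 j.+1 by rewrite /kernel_minor /bump leqnn.
rewrite e1 in hi; rewrite e0 in lo.
have p0 : 0 < A 0%N j by apply: A0 => //; apply: ltnW.
have q0 : 0 < A 0%N j.+1 by apply: A0.
have cj : 0 < ck R k ^+ j.+1 by rewrite exprn_gt0.
apply: (@le_trans _ _ (A 0%N j.+1 * (P * A j.+1 j * Z))); first by rewrite ler_pM2l.
apply: (@le_trans _ _ (A 0%N j * ((ck R k)^-1 ^+ j.+1 * (P * A j.+1 j.+1) * Z)));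
  last by rewrite ler_pM2l.
rewrite exprVn -(ler_pM2l cj).
have -> : ck R k ^+ j.+1 * (A 0%N j.+1 * (P * A j.+1 j * Z)) =
   (ck R k ^+ j.+1 * A 0%N j.+1 * A j.+1 j) * (P * Z) by ring.
have -> : ck R k ^+ j.+1 *
    (A 0%N j * ((ck R k ^+ j.+1)^-1 * (P * A j.+1 j.+1) * Z)) =
   (A 0%N j * A j.+1 j.+1) * (P * Z) by field; rewrite gt_eqF.
by rewrite ler_pM2r // mulr_gt0.
Qed.

(** The alternating first-row expansion lies between its first two partial sums, and
    the second term is estimated by peeling its corner entry [A 1 0]. *)
Lemma leading_minor_three_term (R : realType) (k n : nat)
    (A : nat -> nat -> R) :
  (forall m, (m < n.+1)%N -> corner_bounds R k m) -> (n.+1 < k)%N ->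
  gap_kernel (ck R k) n.+2 A ->
  A 0%N 0%N * leading_minor n.+1 (kernel_shift 1 A)
    - A 0%N 1%N * A 1%N 0%N * leading_minor n (kernel_shift 2 A)
    <= leading_minor n.+2 A
    <= A 0%N 0%N * leading_minor n.+1 (kernel_shift 1 A).
Proof.
move=> H nk GA; set T := fun j => A 0%N j * leading_minor n.+1 (kernel_minor j A).
have A0 i l : (i <= n.+1)%N -> (l <= n.+1)%N -> 0 < A i l by case: GA => + _; apply.
have Tge0 j : (j <= n.+1)%N -> 0 <= T j.
  move=> jn; rewrite mulr_ge0 ?ltW ?A0 //.
  by apply: leading_minor_gt0 (gap_kernel_minor j GA).
have Td j (jn : (j < n.+1)%N) : T j.+1 <= T j :=
  first_row_terms_decrease H nk GA jn.
have T1 : T 1%N <= A 0%N 1%N * A 1%N 0%N * leading_minor n (kernel_shift 2 A).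
  rewrite -mulrA ler_pM2l ?A0 //.
  have /andP[_] := H n (ltnSn n) _ (gap_kernel_minor 1 GA).
  by apply.
have e0 : T 0%N = A 0%N 0%N * leading_minor n.+1 (kernel_shift 1 A) by [].
have -> : leading_minor n.+2 A = \sum_(j < n.+2) (-1) ^+ j * T j.
  exact: leading_minor_expand.
have /andP[_ hi] := alternating_sum_bounds Tge0 Td.
rewrite -e0 hi andbT.
(* The upper estimate for the tail that starts at the term [T 1]. *)
have /andP[_ lo] := @alternating_sum_bounds _ n (fun j => T j.+1)
  (fun j => Tge0 j.+1) (fun j => Td j.+1).
rewrite big_ord_recl expr0 mul1r.
under eq_bigr => j _ do rewrite lift0 exprS mulN1r mulNr.
by rewrite sumrN lerD2l lerN2 (le_trans lo).
Qed.

(** Feeding the induction hypothesis for the shifted kernel into the three-term bound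
    reproduces the recurrence [cos_ratioS]. *)
Lemma corner_bounds_all (R : realType) (k n : nat) : (1 < k)%N -> (n < k)%N ->
  corner_bounds R k n.
Proof.
move=> k1; elim/ltn_ind: n => -[|n] IH nk A GA.
  rewrite cos_ratio0 // mul1r leading_minor0 mulr1.
  by rewrite /leading_minor det_mx11 mxE lexx.
have H m : (m < n.+1)%N -> corner_bounds R k m.
  by move=> mn; apply: IH => //; apply: ltn_trans nk.
have /andP[lo hi] := leading_minor_three_term H nk GA.
rewrite hi andbT; apply: le_trans lo.
have /andP[lo _] := H n (ltnSn n) _ (gap_kernel_shift (s := 1) GA).
have Z0 : 0 < leading_minor n (kernel_shift 2 A).
  apply: (leading_minor_gt0 (k := k)) => [m mn||].
  - exact/H/ltnW.
  - exact: ltnW.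
  - exact: (gap_kernel_shift (s := 2) GA).
have [A0 Ag] := GA.
have := Ag 0%N 1%N 0%N 1%N isT isT.
have := A0 0%N 0%N isT isT; have := A0 1%N 1%N isT isT.
have := cos_ratio_gt0 R nk; have := ck_gt0 R k1.
rewrite cos_ratioS //.
rewrite [leading_minor n _](_ : _ = leading_minor n (kernel_shift 2 A)) // in lo.
move: lo; rewrite [kernel_shift 1 A _ _](_ : _ = A 1%N 1%N) //.
set c := ck R k; set r := cos_ratio R k n; set Z := leading_minor n _ in Z0 *.
set Y := leading_minor n.+1 _; set a := A 0%N 0%N; set d := A 1%N 1%N.
set b := A 0%N 1%N * _ => lo c0 r0 d0 a0; rewrite -mulrA -/b => gap.
have bZ : b * Z <= a * d / c * Z.
  by rewrite ler_pM2r // ler_pdivlMr // mulrC.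
have dZ : d * Z <= Y / r by rewrite ler_pdivlMr // mulrC mulrA.
have : a * d / c * Z <= a * Y * (c * r)^-1.
  have -> : a * d / c * Z = a / c * (d * Z) by ring.
  have -> : a * Y * (c * r)^-1 = a / c * (Y / r) by rewrite invfM; ring.
  by rewrite ler_pM2l ?divr_gt0.
move=> /(le_trans bZ) h.
have -> : (1 - (c * r)^-1) * a * Y = a * Y - a * Y * (c * r)^-1 by ring.
by rewrite lerD2l lerN2.
Qed.

(** For [p.+2 = k] the ratio [cos_ratio R k p.+1] is 0, so the corner bounds alone
    do not give strict positivity.  The strict gap is therefore used directly, in the
    form [(A 0 0 * A 1 1 / c - A 0 1 * A 1 0) * D''] with [D''] the minor left after
    two rows and columns. *)
Lemma leading_minor_sign (R : realType) (C : bool) (k p : nat)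
    (A : nat -> nat -> R) :
  (p.+2 <= k)%N -> gap_kernel (ck R k) p.+2 A ->
  ck R k * A 0%N 1%N * A 1%N 0%N < A 0%N 0%N * A 1%N 1%N ?<= if C ->
  0 < leading_minor p.+2 A ?<= if C.
Proof.
move=> pk GA gap; have k1 : (1 < k)%N by apply: leq_trans pk.
have H n : (n < k)%N -> corner_bounds R k n by move=> nk; apply: corner_bounds_all.
have H1 m : (m < p.+1)%N -> corner_bounds R k m by move=> mp; apply: H; lia.
have /andP[lo _] := leading_minor_three_term H1 pk GA.
have /andP[lo' _] := H1 p (ltnSn p) _ (gap_kernel_shift (s := 1) GA).
have Z0 : 0 < leading_minor p (kernel_shift 2 A).
  apply: (leading_minor_gt0 (k := k)) => [m mn||]; [apply: H1|..]; try lia.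
  exact: (gap_kernel_shift (s := 2) GA).
have [A0 _] := GA.
have a0 := A0 0%N 0%N isT isT; have d0 := A0 1%N 1%N isT isT.
have c0 := ck_gt0 R k1; have r0 := cos_ratio_geVck R pk.
rewrite [leading_minor p _](_ : _ = leading_minor p (kernel_shift 2 A)) // in lo'.
move: lo' lo a0 d0 gap; rewrite [kernel_shift 1 A _ _](_ : _ = A 1%N 1%N) //.
set Z := leading_minor p _ in Z0 *.
set Y := leading_minor p.+1 _; set a := A 0%N 0%N; set d := A 1%N 1%N.
rewrite -mulrA; set b := A 0%N 1%N * _ => lo' lo a0 d0 gap.
have {}gap : 0 < (a * d / ck R k - b) * Z ?<= if C.
  have : b < a * d / ck R k ?<= if C by rewrite lteif_pdivlMr // mulrC mulrA.
  case: (C) => /= [|h]; last by rewrite mulr_gt0 // subr_gt0.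
  by rewrite -subr_ge0 => h; rewrite mulr_ge0 // ltW.
suff h : (a * d / ck R k - b) * Z <= leading_minor p.+2 A.
  by case: C gap => /= g; [apply: le_trans h|apply: lt_le_trans h].
apply: le_trans lo; rewrite mulrBl lerD2r.
have -> : a * d / ck R k * Z = a * ((ck R k)^-1 * (d * Z)) by ring.
by rewrite ler_pM2l // (le_trans _ lo') // ler_pM2r // mulr_gt0.
Qed.

(** * Minors of a matrix with large gaps *)

(** The comparison is made at the critical constant: as [c >= ck R k], the matrix also
    has gap [ck R k], and so does any submatrix. *)
Lemma minors_of_gap_matrix (R : realType) (C : bool) (k : nat) (c : R)
    (m n : nat) (M : 'M[R]_(m, n)) :
  (1 < k)%N -> ck R k <= c -> (forall i j, 0 < M i j) ->
  (forall (i i' : 'I_m) (j j' : 'I_n), i' = i.+1 :> nat -> j' = j.+1 :> nat ->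
     c * M i j' * M i' j < M i j * M i' j' ?<= if C) ->
  forall (p : nat) (f : 'I_p -> 'I_m) (g : 'I_p -> 'I_n),
    (p <= k)%N -> ord_increasing f -> ord_increasing g ->
    0 < \det (mxsub f g M) ?<= if C.
Proof.
move=> k1 hc M0 adj p f g pk fi gi.
have gaps (i i' : 'I_m) (j j' : 'I_n) : (i < i')%N -> (j < j')%N ->
    ck R k * M i j' * M i' j < M i j * M i' j' ?<= if C.
  apply: gap_spread => //; first exact: ck_ge1.
  move=> {}i {}i' {}j {}j' ei ej; have := adj i i' j j' ei ej.
  have le : ck R k * M i j' * M i' j <= c * M i j' * M i' j.
    by rewrite !ler_pM2r.
  by case: (C) => /= h; [apply: le_trans h|apply: le_lt_trans h].
case: p f g pk fi gi => [|[|p]] f g pk fi gi.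
- by rewrite det_mx00 ltrW_lteif.
- by rewrite det_mx11 mxE ltrW_lteif.
pose A i j := M (f (inord i)) (g (inord j)).
have -> : \det (mxsub f g M) = leading_minor p.+2 A.
  by congr (\det _); apply/matrixP => i j; rewrite !mxE /A !inord_val.
have lt_f a b : (a < b < p.+2)%N -> (f (inord a) < f (inord b))%N.
  by move=> /andP[ab bp]; apply: fi; rewrite !inordK // (ltn_trans ab).
have lt_g a b : (a < b < p.+2)%N -> (g (inord a) < g (inord b))%N.
  by move=> /andP[ab bp]; apply: gi; rewrite !inordK // (ltn_trans ab).
apply: leading_minor_sign pk _ _ => //.
  split=> [i j _ _|i i' j j' hi hj]; first exact: M0.
  by apply: (lteifW (C := C)); apply: gaps; [exact: lt_f|exact: lt_g].
by apply: gaps; [exact: lt_f|exact: lt_g].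
Qed.

Theorem theorem2 (R : realType) (k : nat) (hk : (2 <= k)%N) (c : R)
    (hc : ck R k <= c) (m n : nat) (M : 'M[R]_(m, n)) :
  (TP2 c M -> TP k M) /\ (STP2 c M -> STP k M).
Proof.
by split=> -[M0 adj] p f g; [apply: (minors_of_gap_matrix (C := true))
  |apply: (minors_of_gap_matrix (C := false))]; eassumption.
Qed.
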